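(* For every nonnegative integer $n$, $$pod(n)=\sum_{j=-\infty}^{\infty}(-1)^j\,a(n-2j^2).$$
   Context: $pod(n)$ denotes the number of partitions of $n$ in which odd parts are distinct and even parts may be repeated, with $pod(0)=1$. $a(n)$ is the cubic partition function: the number of partitions of $n$ in which the even parts can appear in two colors, with $a(0)=1$ and $a(m)=0$ for $m<0$; its generating function is $\sum_{n\ge0}a(n)q^n=\prod_{k\ge1}\frac{1}{(1-q^k)(1-q^{2k})}$. *)

(* Defs.v *)
From HB Require Import structures.
From mathcomp Require Import all_boot all_order all_algebra.

Set Implicit Arguments.
Unset Strict Implicit.
Unset Printing Implicit Defensive.

(* A partition is a multiset of positive integers, given by the multiplicities
   of its parts.  In a partition of n, all parts and all multiplicities are at
   most n, so it is a function m from 'I_n to 'I_n.+1, in which m i is the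
   multiplicity of the part i.+1.  For n = 0 the only such function is the
   empty one, which represents the empty partition. *)

Definition pod_partitions (n : nat) : {set {ffun 'I_n -> 'I_n.+1}} :=
  [set m : {ffun 'I_n -> 'I_n.+1} |
    (\sum_(i < n) m i * i.+1 == n) && [forall i : 'I_n, odd i.+1 ==> (m i <= 1)]].

Definition pod (n : nat) : nat := #|pod_partitions n|.

(* Parts in two colors: m (i, c) is the multiplicity of the part i.+1 in
   color c; odd parts only occur in the color false. *)
Definition cubic_partitions (n : nat) :
    {set {ffun 'I_n * bool -> 'I_n.+1}} :=
  [set m : {ffun 'I_n * bool -> 'I_n.+1} |
    (\sum_(p : 'I_n * bool) m p * p.1.+1 == n)
    && [forall i : 'I_n, odd i.+1 ==> (m (i, true) == 0 :> nat)]].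

Definition cubic (m : int) : nat :=
  match m with
  | Posz k => #|cubic_partitions k|
  | Negz _ => 0
  end.

(* Main.v *)
(* Modulo q^(n+1) the generating functions satisfy
     sum pod(n) q^n = prod (1 + q^(2k-1)) / (1 - q^(2k)),
     sum a(n) q^n   = prod 1 / ((1 - q^k) (1 - q^(2k))),
   so it suffices that
     sum_j (-1)^j q^(2j^2) = prod (1 + q^(2k-1)) (1 - q^k).
   This follows from Gauss's identity
     sum_j (-1)^j x^(j^2) = prod (1 - x^(2k-1))^2 (1 - x^(2k))  at x = q^2.
   Its finite form is the q-binomial theorem for
   prod_(i < 2m) (a + b y^i) at y = x^2, a = x^(2m-1), b = -1, and the Gaussian
   binomials [2m, m+j] tend to prod 1 / (1 - y^k). *)
Require Import Defs.
From HB Require Import structures.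
From mathcomp Require Import all_boot all_order all_algebra.
From mathcomp Require Import classical_sets fsbigop.
From mathcomp Require Import zify ring.

Set Implicit Arguments.
Unset Strict Implicit.
Unset Printing Implicit Defensive.

Import Order.TTheory GRing.Theory Num.Theory.

Local Open Scope classical_set_scope.
Local Open Scope ring_scope.

(** * Gaussian binomials and the q-binomial theorem *)

(** Gaussian binomials through a q-Pascal rule: without division, [y] may be any element of a
    commutative ring, such as a power of X. *)
Fixpoint qbin (R : comNzRingType) (y : R) (N k : nat) : R :=
  match N, k with
  | _, 0 => 1
  | 0, _.+1 => 0
  | N'.+1, k'.+1 => y ^+ k * qbin y N' k + qbin y N' k'
  end.

(** The q-Pochhammer symbol (y; y)_N. *)
Definition qfact (R : comNzRingType) (y : R) (N : nat) : R :=
  \prod_(i < N) (1 - y ^+ i.+1).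

Lemma qbin0 (R : comNzRingType) (y : R) N : qbin y N 0 = 1.
Proof. by case: N. Qed.

Lemma qbin_small (R : comNzRingType) (y : R) N k : (N < k)%N -> qbin y N k = 0.
Proof.
elim: N k => [|N IH] [|k] //= ltNk.
by rewrite !IH ?mulr0 ?addr0 // ltnW.
Qed.

(** Induction with [b] general: splitting off the factor at [i = 0] leaves the product for [b * y],
    and the q-Pascal rule recombines the two sums. *)
Lemma qbin_theorem (R : comNzRingType) (y a b : R) N :
  \prod_(i < N) (a + b * y ^+ i) =
  \sum_(k < N.+1) y ^+ 'C(k, 2) * qbin y N k * a ^+ (N - k) * b ^+ k.
Proof.
elim: N b => [|N IH] b.
  by rewrite big_ord0 big_ord_recl big_ord0 /= !expr0 !mulr1 addr0.
rewrite big_ord_recl expr0 mulr1.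
under eq_bigr => i _ do rewrite /= /bump leq0n add1n exprS mulrA.
rewrite IH mulrDl [a * _]mulr_sumr [b * \sum_(_ < _) _]mulr_sumr.
rewrite [in RHS]big_ord_recl /= bin0n expr0 subn0 !mulr1 mul1r.
rewrite [X in X + _]big_ord_recl qbin0 bin0n expr0 subn0 !mulr1 mul1r -exprS.
rewrite -addrA; congr (_ + _).
rewrite [in RHS](eq_bigr (fun k : 'I_N.+1 =>
  a * (y ^+ 'C(k.+1, 2) * qbin y N k.+1 * a ^+ (N - k.+1) * (b * y) ^+ k.+1) +
  b * (y ^+ 'C(k, 2) * qbin y N k * a ^+ (N - k) * (b * y) ^+ k))).
  rewrite big_split /=; congr (_ + _).
  by rewrite big_ord_recr /= qbin_small // !(mulr0, mul0r) addr0.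
move=> k _; rewrite /= /bump leq0n add1n subSS binS bin1.
rewrite !exprMn !exprD.
have [->|ltkN] : k = N :> nat \/ (k < N)%N by have := ltn_ord k; lia.
  by rewrite add0n qbin_small // !exprS;
     move: (N - N.+1)%N (N - N)%N (binomial _ _) => c d e; ring.
by rewrite add0n -(subnSK ltkN) !exprS;
   move: (N - k.+1)%N (binomial _ _) => d e; ring.
Qed.

(** The quotient formula for Gaussian binomials, cleared of denominators. *)
Lemma qbin_fact (R : comNzRingType) (y : R) N k : (k <= N)%N ->
  qbin y N k * (qfact y k * qfact y (N - k)) = qfact y N.
Proof.
have qfactS j : qfact y j.+1 = qfact y j * (1 - y ^+ j.+1).
  by rewrite /qfact big_ord_recr.
have qfact0 : qfact y 0 = 1 by rewrite /qfact big_ord0.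
elim: N k => [|N IH] [|k] //= lekN.
- by rewrite qfact0 !mulr1.
- by rewrite qfact0 !mul1r.
rewrite subSS.
have IHk := IH k lekN.
have [eqkN|ltkN] : k = N \/ (k < N)%N by lia.
  subst k; rewrite qbin_small // subnn qfactS -[in RHS]IHk subnn; ring.
have := IH k.+1 ltkN.
rewrite -(subnSK ltkN) !qfactS in IHk * => IHk1.
(* The splitting 1 - y^(N+1) = y^(k+1) (1 - y^(N-k)) + (1 - y^(k+1)) matches the two terms of the
   q-Pascal rule. *)
have -> : y ^+ N.+1 = y ^+ k.+1 * y ^+ (N - k.+1).+1.
  by rewrite -exprD; congr (_ ^+ _); lia.
have -> : (y ^+ k.+1 * qbin y N k.+1 + qbin y N k) *
  (qfact y k * (1 - y ^+ k.+1) * (qfact y (N - k.+1) * (1 - y ^+ (N - k.+1).+1)))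
 = y ^+ k.+1 * (1 - y ^+ (N - k.+1).+1) *
   (qbin y N k.+1 * (qfact y k * (1 - y ^+ k.+1) * qfact y (N - k.+1)))
  + (1 - y ^+ k.+1) *
   (qbin y N k * (qfact y k * (qfact y (N - k.+1) * (1 - y ^+ (N - k.+1).+1)))).
  by ring.
by rewrite IHk1 IHk; ring.
Qed.

(** * Gauss's identity in finite form *)

Lemma double_bin2 k : (2 * 'C(k, 2) = k * (k - 1))%N.
Proof. by rewrite -mul_bin_diag bin1 subn1. Qed.

(** The absolute difference: at least one of the truncated subtractions is 0. *)
Definition dist (m k : nat) : nat := (m - k + (k - m))%N.

(** Completing the square in the exponent of x in the k-th term of the q-binomial theorem;
    [3 * m ^ 2 - 2 * m] is the part independent of k. *)
Lemma gauss_exponent m k : (k <= 2 * m)%N ->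
  (k * (k - 1) + (2 * m - 1) * (2 * m - k) = dist m k ^ 2 + (3 * m ^ 2 - 2 * m))%N.
Proof.
move=> le_k.
have [e def_e] : exists e, (2 * m = k + e)%N by exists (2 * m - k)%N; lia.
have -> : (2 * m - k = e)%N by lia.
have k2 : (k * (k - 1) + k = k * k)%N by case: k {le_k def_e} => // k; rewrite subn1; lia.
have e2 : ((2 * m - 1) * e + e = 2 * m * e)%N.
  case: m le_k def_e => [|m] _ def_e; first by have -> : e = 0%N by lia.
  by rewrite -mulSnr; congr (_ * _)%N; lia.
have m2 : (3 * m ^ 2 - 2 * m + 2 * m = 3 * m ^ 2)%N.
  by rewrite subnK // -mulnn mulnA leq_mul2r; case: m {le_k def_e e2} => // m; lia.
suff: (k * k + 2 * m * e = dist m k ^ 2 + 3 * m ^ 2)%N by lia.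
rewrite /dist; have [[d md]|[d kd]] : (exists d, m = k + d)%N \/ (exists d, k = m + d)%N.
- by have [le|lt] := leqP m k; [right; exists (k - m)%N | left; exists (m - k)%N]; lia.
- have -> : e = (k + 2 * d)%N by lia.
  have -> : (m - k + (k - m) = d)%N by lia.
  by rewrite md; ring.
- have me : m = (e + d)%N by lia.
  have -> : (m - k + (k - m) = d)%N by lia.
  by rewrite kd me; ring.
Qed.

(** The factors of the q-binomial product are x^(2m-1) - x^(2i). Pulling out x^(2i) for i < m and
    x^(2m-1) for i >= m leaves the same product of factors 1 - x^odd in both halves, up to sign. The
    powers pulled out multiply to x^(3m^2-2m), which cancels. *)
Lemma finite_gauss (R : idomainType) (x : R) m : x != 0 ->
  \prod_(i < m) (1 - x ^+ (2 * i + 1)) ^+ 2 =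
  \sum_(k < (2 * m).+1) (-1) ^+ (m + k) * x ^+ (dist m k ^ 2)
     * qbin (x ^+ 2) (2 * m) k.
Proof.
move=> x0.
have xn0 : x ^+ (3 * m ^ 2 - 2 * m) != 0 by rewrite expf_neq0.
apply: (mulIf xn0).
have lowE : \prod_(i < m) (x ^+ (2 * m - 1) + -1 * (x ^+ 2) ^+ i) =
    (-1) ^+ m * x ^+ (m * (m - 1)) * \prod_(i < m) (1 - x ^+ (2 * i + 1)).
  (* The factor at i is -x^(2i) (1 - x^(2(m-1-i)+1)), so the odd exponents appear in reverse
     order. *)
  rewrite [in RHS](reindex_inj rev_ord_inj) /=.
  have -> : (-1 : R) ^+ m = \prod_(i < m) (-1) by rewrite prodr_const card_ord.
  have -> : x ^+ (m * (m - 1)) = \prod_(i < m) x ^+ (2 * i).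
    by rewrite -expr_sum -big_distrr /= -double_bin2 -bin2_sum big_mkord.
  rewrite -!big_split /=; apply: eq_bigr => i _.
  have -> : (2 * m - 1 = 2 * i + (2 * (m - i.+1) + 1))%N by have := ltn_ord i; lia.
  by rewrite exprD -exprM; ring.
have highE : \prod_(i < m) (x ^+ (2 * m - 1) + -1 * (x ^+ 2) ^+ (m + i)) =
    x ^+ (m * (2 * m - 1)) * \prod_(i < m) (1 - x ^+ (2 * i + 1)).
  have -> : x ^+ (m * (2 * m - 1)) = \prod_(i < m) x ^+ (2 * m - 1).
    by rewrite prodr_const card_ord -exprM mulnC.
  rewrite -!big_split /=; apply: eq_bigr => i _.
  have -> : (x ^+ 2) ^+ (m + i) = x ^+ (2 * m - 1) * x ^+ (2 * i + 1).
    by rewrite -exprM -exprD; congr (_ ^+ _); have := ltn_ord i; lia.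
  by ring.
have := qbin_theorem (x ^+ 2) (x ^+ (2 * m - 1)) (-1) (2 * m).
have -> : \prod_(i < 2 * m) (x ^+ (2 * m - 1) + -1 * (x ^+ 2) ^+ i) =
    \prod_(i < m) (x ^+ (2 * m - 1) + -1 * (x ^+ 2) ^+ i) *
    \prod_(i < m) (x ^+ (2 * m - 1) + -1 * (x ^+ 2) ^+ (m + i)).
  by rewrite mul2n -addnn big_split_ord.
rewrite lowE highE => thm.
(* The extra (-1)^m cancels the sign of the lower half and turns (-1)^k into (-1)^(m+k). *)
transitivity ((-1) ^+ m *
  ((-1) ^+ m * x ^+ (m * (m - 1)) * \prod_(i < m) (1 - x ^+ (2 * i + 1)) *
   (x ^+ (m * (2 * m - 1)) * \prod_(i < m) (1 - x ^+ (2 * i + 1))))).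
  have -> : (3 * m ^ 2 - 2 * m = m * (m - 1) + m * (2 * m - 1))%N
    by rewrite -mulnDr; case: (m) => // k;
       rewrite -mulnn mulnA -mulnBl mulnC; congr (_ * _)%N; lia.
  rewrite prodrXl exprD.
  have: (-1) ^+ m * (-1) ^+ m = 1 :> R by rewrite -exprD addnn -mul2n exprM sqrrN !expr1n.
  set s := _ ^+ m; move=> ss.
  transitivity (s * s * (x ^+ (m * (m - 1)) * \prod_(i < m) (1 - x ^+ (2 * i + 1)) *
   (x ^+ (m * (2 * m - 1)) * \prod_(i < m) (1 - x ^+ (2 * i + 1))))); last by ring.
  by rewrite ss; ring.
rewrite thm mulr_sumr mulr_suml; apply: eq_bigr => k _.
have -> : (x ^+ 2) ^+ 'C(k, 2) = x ^+ (k * (k - 1)).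
  by rewrite -exprM double_bin2.
have e := gauss_exponent (ltnSE (ltn_ord k)).
rewrite -[in LHS]exprM exprD.
transitivity ((-1) ^+ m * (-1) ^+ k *
  x ^+ (k * (k - 1) + (2 * m - 1) * (2 * m - k)) * qbin (x ^+ 2) (2 * m) k).
  by rewrite exprD; ring.
by rewrite e exprD; ring.
Qed.

(** * Congruence of polynomials modulo a power of X, in place of power series *)

Definition eqmodX (R : comNzRingType) (N : nat) (p q : {poly R}) : Prop :=
  forall i, (i < N)%N -> p`_i = q`_i.

Lemma eqmodX_refl (R : comNzRingType) N (p : {poly R}) : eqmodX N p p.
Proof. by []. Qed.

Lemma eqmodX_sym (R : comNzRingType) N (p q : {poly R}) :
  eqmodX N p q -> eqmodX N q p.
Proof. by move=> pq i iN; rewrite pq. Qed.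

Lemma eqmodX_trans (R : comNzRingType) N (q p r : {poly R}) :
  eqmodX N p q -> eqmodX N q r -> eqmodX N p r.
Proof. by move=> pq qr i iN; rewrite pq ?qr. Qed.

Lemma eqmodX_leq (R : comNzRingType) M N (p q : {poly R}) :
  (M <= N)%N -> eqmodX N p q -> eqmodX M p q.
Proof. by move=> leMN pq i iM; apply/pq/(leq_trans iM). Qed.

Lemma eqmodXM (R : comNzRingType) N (p q r s : {poly R}) :
  eqmodX N p q -> eqmodX N r s -> eqmodX N (p * r) (q * s).
Proof.
move=> pq rs i iN; rewrite !coefM; apply: eq_bigr => j _.
by rewrite pq ?rs //; have := ltn_ord j; lia.
Qed.

Lemma eqmodX_sum (R : comNzRingType) N (I : finType) (f g : I -> {poly R}) :
  (forall i, eqmodX N (f i) (g i)) -> eqmodX N (\sum_i f i) (\sum_i g i).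
Proof. by move=> fg k kN; rewrite !coef_sum; apply: eq_bigr => i _; apply: fg. Qed.

Lemma eqmodX_prod (R : comNzRingType) N (I : finType) (f g : I -> {poly R}) :
  (forall i, eqmodX N (f i) (g i)) -> eqmodX N (\prod_i f i) (\prod_i g i).
Proof.
move=> fg; apply: (big_rec2 (eqmodX N)) => [|i p q _ pq].
  exact: eqmodX_refl.
exact: eqmodXM.
Qed.

Lemma eqmodX_prod_widen (R : comNzRingType) N m n (f : nat -> {poly R}) :
    (m <= n)%N -> (forall i, (m <= i)%N -> eqmodX N (f i) 1) ->
  eqmodX N (\prod_(i < n) f i) (\prod_(i < m) f i).
Proof.
move=> lemn f1; rewrite (big_ord_widen n f lemn) [X in eqmodX _ _ X]big_mkcond /=.
apply: eqmodX_prod => i; case: ltnP => [_|/f1 //]; exact: eqmodX_refl.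
Qed.

Lemma eqmodX_cancel (R : comNzRingType) N (u p q : {poly R}) :
  u`_0 = 1 -> eqmodX N (u * p) (u * q) -> eqmodX N p q.
Proof.
move=> u0 upq i; elim/ltn_ind: i => i IH iN.
have := upq i iN; rewrite !coefM !big_ord_recl !u0 !mul1r subn0.
rewrite (eq_bigr (fun j : 'I_i => u`_(lift ord0 j) * q`_(i - lift ord0 j))).
  exact: addIr.
by move=> j _; rewrite IH //= /bump; have := ltn_ord j; lia.
Qed.

Lemma eqmodX_1BXn (R : comNzRingType) N k :
  (N <= k)%N -> eqmodX N (1 - 'X^k : {poly R}) 1.
Proof.
move=> leNk i iN; rewrite coefB coefXn; case: eqP => [ik|_]; first lia.
by rewrite subr0.
Qed.

Lemma coef0_1BXn (R : comNzRingType) k : (0 < k)%N -> (1 - 'X^k : {poly R})`_0 = 1.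
Proof. by move=> k0; rewrite (eqmodX_1BXn R k0) // coef1. Qed.

(** The product telescopes to 1 - X^((n+1)w), and (n+1)w > n. *)
Lemma eqmodX_geometric (R : comNzRingType) n w : (0 < w)%N ->
  eqmodX n.+1 ((1 - 'X^w) * \sum_(k < n.+1) 'X^(k * w)) (1 : {poly R}).
Proof.
move=> w0.
have -> : \sum_(k < n.+1) 'X^(k * w) = \sum_(k < n.+1) 'X^w ^+ k :> {poly R}.
  by apply: eq_bigr => k _; rewrite mulnC exprM.
rewrite -opprB mulNr -subrX1 opprB -exprM.
by apply: eqmodX_1BXn; case: w w0 => // w _; lia.
Qed.

(** * Generating polynomials of the two kinds of partitions *)

(** Expanding the product chooses an admissible multiplicity for each part; a choice [m] contributes
    X to the power of its total weight. *)
Lemma coef_prod_multiplicities (R : comNzRingType) (I : finType) n i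
    (w : I -> nat) (P : I -> nat -> bool) :
  (\prod_p \sum_(k < n.+1 | P p k) 'X^(k * w p) : {poly R})`_i =
  #|[set m : {ffun I -> 'I_n.+1} |
     (\sum_p m p * w p == i)%N && [forall p, P p (m p)]]%SET|%:R.
Proof.
rewrite bigA_distr_big_dep coef_sum -sum1_card natr_sum.
rewrite big_mkcond [in RHS]big_mkcond; apply: eq_bigr => m _.
rewrite !inE -expr_sum coefXn eq_sym (_ : [forall x, _] = [forall p, P p (m p)]) //.
by case: eqP; case: [forall _, _].
Qed.

Definition pod_poly (n : nat) : {poly int} :=
  \prod_(i < n) \sum_(k < n.+1 | odd i.+1 ==> (k <= 1)%N) 'X^(k * i.+1).

Definition cubic_poly (n : nat) : {poly int} :=
  \prod_(p : 'I_n * bool)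
    \sum_(k < n.+1 | odd p.1.+1 && p.2 ==> (k == 0 :> nat)) 'X^(k * p.1.+1).

Lemma coef_pod_poly n : (pod_poly n)`_n = (pod n)%:Z.
Proof.
rewrite /pod_poly (coef_prod_multiplicities _ _ _ (fun i : 'I_n => i.+1)
  (fun i k => odd i.+1 ==> (k <= 1)%N)).
by rewrite natz.
Qed.

Lemma coef_cubic_poly_diag n : (cubic_poly n)`_n = (cubic n)%:Z.
Proof.
rewrite /cubic_poly (coef_prod_multiplicities _ _ _ (fun p : 'I_n * bool => p.1.+1)
  (fun p k => odd p.1.+1 && p.2 ==> (k == 0 :> nat))).
rewrite natz; congr (Posz _); apply: eq_card => m; rewrite !inE; congr (_ && _).
apply/forallP/forallP => [H i|H [i []]] /=.
- by have /= := H (i, true); rewrite andbT.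
- by rewrite andbT; apply: H.
- by rewrite andbF.
Qed.

(* The factor of the part i in prod (1 - q^(2k)). *)
Definition evenfac (i : nat) : {poly int} := if odd i then 1 else 1 - 'X^i.

Definition cubic_den (n : nat) : {poly int} :=
  \prod_(i < n) ((1 - 'X^(i.+1)) * evenfac i.+1).

Lemma coef0_cubic_den n : (cubic_den n)`_0 = 1.
Proof.
rewrite coef0_prod big1 // => i _; rewrite coef0M coef0_1BXn // mul1r.
by rewrite /evenfac; case: ifP => _; rewrite ?coef1 ?coef0_1BXn.
Qed.

Lemma cubic_poly_inv n : eqmodX n.+1 (cubic_den n * cubic_poly n) 1.
Proof.
have -> : cubic_den n =
    \prod_(p : 'I_n * bool)
      (if odd p.1.+1 && p.2 then 1 else 1 - 'X^(p.1.+1)) :> {poly int}.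
  rewrite -(pair_bigA _ (fun (i : 'I_n) c =>
    if odd i.+1 && c then 1 else 1 - 'X^(i.+1) : {poly int})).
  by apply: eq_bigr => i _; rewrite big_bool /= andbT andbF mulrC.
rewrite /cubic_poly -big_split /=.
apply: (@eqmodX_trans _ _ (\prod_(p : 'I_n * bool) 1)); last by rewrite big1.
apply: eqmodX_prod => -[i c] /=; case: ifP => _.
  rewrite mul1r (big_pred1 ord0) ?expr0 // => k; exact: eqmodX_refl.
exact: eqmodX_geometric.
Qed.

(** The bounds on parts and multiplicities differ, n on one side and k on the other. Modulo X^(k+1),
    however, both polynomials are inverse to [cubic_den k]. *)
Lemma coef_cubic_poly n k : (k <= n)%N -> (cubic_poly n)`_k = (cubic k)%:Z.
Proof.
move=> lekn; rewrite -coef_cubic_poly_diag.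
suff: eqmodX k.+1 (cubic_poly n) (cubic_poly k) by apply.
apply: (@eqmodX_cancel _ _ (cubic_den k)).
  exact: coef0_cubic_den.
apply: (@eqmodX_trans _ _ 1); last exact/eqmodX_sym/cubic_poly_inv.
apply: (@eqmodX_trans _ _ (cubic_den n * cubic_poly n)); last first.
  by apply: (@eqmodX_leq _ _ n.+1) => //; apply: cubic_poly_inv.
apply: eqmodXM; last exact: eqmodX_refl.
apply: eqmodX_sym.
apply: (@eqmodX_prod_widen _ _ _ _
  (fun i => (1 - 'X^(i.+1)) * evenfac i.+1)) => // i leki.
rewrite -[X in eqmodX _ _ X]mul1r; apply: eqmodXM; first exact: eqmodX_1BXn.
by rewrite /evenfac; case: ifP => _; [apply: eqmodX_refl | apply: eqmodX_1BXn].
Qed.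

Lemma pod_poly_mul n :
  eqmodX n.+1 (\prod_(i < n) evenfac i.+1 * pod_poly n)
    (\prod_(i < n) (if odd i.+1 then 1 + 'X^(i.+1) else 1 : {poly int})).
Proof.
rewrite /pod_poly -big_split; apply: eqmodX_prod => i.
(* [odd i] means that the part [i.+1] is even, where the geometric series cancels; an odd part
   leaves the terms k = 0 and k = 1. *)
rewrite /evenfac /=; case: (odd i) => /=; first exact: eqmodX_geometric.
(* Ensures that k = 1 lies in the range k < n + 1. *)
have n_gt0 : (0 < n)%N by have := ltn_ord i; lia.
rewrite mul1r big_mkcond /=.
rewrite -(big_mkord xpredT (fun k => if (k <= 1)%N then 'X^(k * i.+1) else 0)).
rewrite (@big_cat_nat _ _ _ 2) //= [X in _ + X]big1_seq; last first.
  by move=> k; rewrite mem_index_iota; case: ifP => //; lia.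
by rewrite addr0 2?big_nat_recr //= big_geq //= mul0n mul1n add0r; apply: eqmodX_refl.
Qed.

(** * The theta series as an infinite product *)

(* The summation index k is j + 2n for |j| <= 2n; as 2n is even, the sign is that
   of (-1)^j. *)
Definition theta (n : nat) : {poly int} :=
  \sum_(k < (4 * n).+1) (-1) ^+ k * 'X^(2 * dist (2 * n) k ^ 2).

Lemma prod_parity (R : comNzRingType) n (f : nat -> R) :
  \prod_(i < 2 * n) f i = \prod_(j < n) f (2 * j)%N * \prod_(j < n) f (2 * j).+1.
Proof.
elim: n => [|n IH]; first by rewrite muln0 !big_ord0 mulr1.
have -> : (2 * n.+1 = (2 * n).+2)%N by lia.
rewrite [in RHS]big_ord_recr [in X in _ = _ * X]big_ord_recr /=.
by rewrite mulrACA -IH !big_ord_recr /= mulrA.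
Qed.

Lemma eqmodX_qfact n (k a b : nat) : (0 < k)%N -> (n <= a)%N -> (n <= b)%N ->
  eqmodX n.+1 (qfact ('X^k : {poly int}) a) (qfact 'X^k b).
Proof.
move=> k0 lena lenb.
suff widen c : (n <= c)%N -> eqmodX n.+1 (qfact ('X^k : {poly int}) c) (qfact 'X^k n).
  exact: eqmodX_trans (widen a lena) (eqmodX_sym (widen b lenb)).
move=> lenc; apply: (@eqmodX_prod_widen _ _ _ _ (fun i => 1 - 'X^k ^+ i.+1)) => // i leni.
by rewrite -exprM; apply: eqmodX_1BXn; case: k k0 => // k _; lia.
Qed.

Lemma coef0_qfact (k a : nat) : (0 < k)%N -> (qfact ('X^k : {poly int}) a)`_0 = 1.
Proof.
move=> k0; rewrite coef0_prod big1 // => i _.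
by rewrite -exprM coef0_1BXn // muln_gt0 k0.
Qed.

(** The limit of the Gaussian binomials: in the quotient formula all three q-factorials agree with
    [qfact 'X^k n] modulo X^(n+1). *)
Lemma eqmodX_qbin n k M j : (0 < k)%N -> (j <= M)%N ->
    (n <= j)%N -> (n <= M - j)%N ->
  eqmodX n.+1 (qbin ('X^k : {poly int}) M j * qfact 'X^k n) 1.
Proof.
move=> k0 lejM lenj lenMj; apply: (@eqmodX_cancel _ _ (qfact 'X^k n)).
  exact: coef0_qfact.
apply: (@eqmodX_trans _ _ (qfact 'X^k M)); last first.
  by rewrite mulr1; apply: eqmodX_qfact => //; lia.
rewrite -(@qbin_fact _ _ M j) //.
rewrite mulrCA; apply: eqmodXM; first exact: eqmodX_refl.
by apply: eqmodXM; apply: eqmodX_qfact.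
Qed.

(** The finite Gauss identity with m = 2n and x = X^2, multiplied by [qfact 'X^4 n] so that the
    Gaussian binomials that matter become 1. *)
Lemma theta_prod n :
  eqmodX n.+1 (theta n)
    (qfact 'X^4 n * \prod_(i < 2 * n) (1 - 'X^2 ^+ (2 * i + 1)) ^+ 2).
Proof.
have X2 : 'X^2 != 0 :> {poly int} by rewrite monic_neq0 ?monicXn.
rewrite (finite_gauss (2 * n) X2) mulr_sumr /theta.
rewrite mulnA; apply: eqmodX_sym; apply: eqmodX_sum => k.
rewrite exprD exprM sqrrN !expr1n mul1r mulrCA mulrA.
rewrite -!mulrA; apply: eqmodXM; first exact: eqmodX_refl.
rewrite -exprM -[X in eqmodX _ _ X]mulr1.
(* Terms of degree above n vanish on both sides. *)
have [small|big] := leqP (2 * dist (2 * n) k ^ 2) n; last first.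
  by move=> i iN; rewrite !coefXnM (leq_trans iN big).
apply: eqmodXM; first exact: eqmodX_refl.
rewrite -exprM mulrC; have le_k := ltn_ord k.
(* As d <= d^2, k stays within n/2 of 2n, so k and 4n - k are both at least n. *)
have le_d : (2 * dist (2 * n) k <= n)%N.
  by apply: leq_trans small; rewrite leq_mul2l /=;
     case: (dist _ _) => // d; rewrite -mulnn leq_pmulr.
by apply: eqmodX_qbin => //; move: le_d; rewrite /dist; lia.
Qed.

(** For odd j, (1 + X^j)(1 - X^j) = 1 - X^(2j), collected in [G]; the even j leave [evenfac]. The
    products of [G] and [evenfac] are congruent to A and A B, while theta is congruent to B A^2. *)
Lemma theta_modX n :
  eqmodX n.+1 (theta n)
    (\prod_(i < n) (if odd i.+1 then 1 + 'X^(i.+1) else 1 : {poly int})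
     * \prod_(i < n) (1 - 'X^(i.+1))).
Proof.
pose F j : {poly int} := 1 - 'X^(2 * j).
pose G j : {poly int} := if odd j then F j else 1.
pose A := \prod_(j < n) F (2 * j + 1)%N.
pose B := \prod_(j < n) F (2 * j + 2)%N.
have F1 k j : (k < j)%N -> eqmodX k.+1 (F j) 1.
  by move=> ltkj; apply: eqmodX_1BXn; lia.
apply: (@eqmodX_trans _ _ (B * A ^+ 2)).
  apply: eqmodX_trans (@theta_prod n) _; apply: eqmodXM.
    suff -> : qfact 'X^4 n = B by apply: eqmodX_refl.
    by apply: eq_bigr => i _; rewrite -exprM /F; congr (1 - 'X^ _); lia.
  rewrite prodrXl expr2; apply: eqmodXM;
    rewrite (eq_bigr (fun j : 'I_(2 * n) => F (2 * j + 1)%N)) /A;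
    try (by move=> i _; rewrite -exprM);
    apply: (@eqmodX_prod_widen _ _ _ _ (fun j => F (2 * j + 1)%N));
    [lia | move=> i leni; apply: F1; lia | lia | move=> i leni; apply: F1; lia].
have -> : \prod_(i < n) (if odd i.+1 then 1 + 'X^(i.+1) else 1) *
      \prod_(i < n) (1 - 'X^(i.+1))
    = \prod_(i < n) G i.+1 * \prod_(i < n) evenfac i.+1.
  rewrite -!big_split; apply: eq_bigr => i _; rewrite /G /evenfac /F.
  case: (odd i.+1); last by [].
  by rewrite mulnC exprM /= mulr1; move: 'X^(i.+1) => x; ring.
have GE : eqmodX n.+1 (\prod_(i < n) G i.+1) A.
  (* Lengthening to 2n factors lets the parity split yield exactly n odd indices; by the shift, even
     i gives odd [i.+1]. *)
  apply: (@eqmodX_trans _ _ (\prod_(i < 2 * n) G i.+1)).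
    apply/eqmodX_sym/(@eqmodX_prod_widen _ _ _ _ (fun i => G i.+1)); first by lia.
    by move=> i leni; rewrite /G; case: ifP => _; [apply: F1 | apply: eqmodX_refl].
  rewrite (prod_parity _ (fun i => G i.+1)) [X in _ * X]big1 => [|i _].
    rewrite mulr1 /A /G; under eq_bigr => i _ do rewrite -addn1 oddD oddM /=.
    exact: eqmodX_refl.
  by rewrite /G /= oddM.
have EE : eqmodX n.+1 (\prod_(i < n) evenfac i.+1) (A * B).
  apply: (@eqmodX_trans _ _ (\prod_(i < 2 * n) evenfac i.+1)).
    apply/eqmodX_sym/(@eqmodX_prod_widen _ _ _ _ (fun i => evenfac i.+1)); first by lia.
    by move=> i leni; rewrite /evenfac; case: ifP => _;
       [apply: eqmodX_refl | apply: eqmodX_1BXn].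
  rewrite (prod_parity _ (fun i => evenfac i.+1)) big1 => [|i _]; last first.
    by rewrite /evenfac /= oddM.
  rewrite mul1r (eq_bigr (fun j : 'I_n => F j.+1)) => [|i _]; last first.
    by rewrite /evenfac /= oddM /F; congr (1 - 'X^ _); lia.
  (* A second lengthening and parity split separates the exponents 2(2j+1) of A from 2(2j+2) of
     B. *)
  apply: (@eqmodX_trans _ _ (\prod_(j < 2 * n) F j.+1)).
    apply/eqmodX_sym/(@eqmodX_prod_widen _ _ _ _ (fun j => F j.+1)); first by lia.
    by move=> i leni; apply: F1.
  rewrite (prod_parity _ (fun j => F j.+1)) /A /B.
  under eq_bigr => i _ do rewrite -addn1.
  under [X in _ * X]eq_bigr => i _ do rewrite -addn2.
  exact: eqmodX_refl.
rewrite (_ : B * A ^+ 2 = A * (A * B)); last by ring.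
by apply: eqmodXM; apply: eqmodX_sym.
Qed.

(** * The convolution identity and its coefficient at n *)

(** Multiplying by [cubic_den n] reduces the right side to theta and the left side to its product
    form. *)
Lemma pod_poly_theta n : eqmodX n.+1 (pod_poly n) (cubic_poly n * theta n).
Proof.
apply: (@eqmodX_cancel _ _ (cubic_den n)).
  exact: coef0_cubic_den.
rewrite mulrA; apply: (@eqmodX_trans _ _ (theta n)); last first.
  rewrite -[X in eqmodX _ X]mul1r; apply: eqmodXM; last exact: eqmodX_refl.
  exact/eqmodX_sym/cubic_poly_inv.
apply/eqmodX_sym/(eqmodX_trans (@theta_modX n)).
rewrite /cubic_den big_split /= mulrC -mulrA; apply: eqmodXM; first exact: eqmodX_refl.
exact/eqmodX_sym/pod_poly_mul.
Qed.

Theorem theorem4p13 (n : nat) :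
  (pod n)%:Z =
  \sum_(j \in [set: int]) (-1) ^ j * (cubic (n%:Z - 2 * j ^+ 2))%:Z.
Proof.
(* The window |j| <= 2n of [theta] contains the support of the sum: outside it |j| > n, so n - 2j^2
   < 0 and [cubic] is 0. *)
pose r : seq int := [seq k%:Z - (2 * n)%:Z | k <- iota 0 (4 * n).+1].
rewrite (@fsbigE _ _ _ int _ r) //; first last.
- move=> j _ jr; have lt_nj : (n < absz j)%N.
    apply: contraNltn jr => le_jn; apply/mapP;
    exists (absz (j + (2 * n)%:Z)); last by lia.
    by rewrite mem_iota; lia.
  have : n%:Z - 2 * j ^+ 2 < 0 by rewrite expr2; nia.
  by case: (_ - _) => // ? _; rewrite mulr0.
- by rewrite map_inj_uniq ?iota_uniq // => a b; lia.
rewrite (eq_bigl xpredT) => [|j]; last by rewrite in_setT.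
rewrite big_map -[iota _ _]/(index_iota 0 (4 * n).+1) big_mkord.
rewrite -coef_pod_poly (pod_poly_theta (ltnSn n)) /theta mulr_sumr coef_sum.
apply: eq_bigr => k _.
have -> : (-1) ^+ k = ((-1) ^+ k)%:P :> {poly int} by rewrite rmorphXn rmorphN1.
rewrite mulrCA coefCM coefMXn; congr (_ * _).
  (* The integer power (-1)^(k-2n) equals (-1)^k, since -1 is its own inverse and 2n is even. *)
  rewrite exprzDr ?unitrN1 // -exprz_inv invrN1 -!exprnP.
  by rewrite exprM sqrrN !expr1n mulr1.
have dE : (k%:Z - (2 * n)%:Z) ^+ 2 = (dist (2 * n) k ^ 2)%:Z.
  have [->|->] : k%:Z - (2 * n)%:Z = dist (2 * n) k \/
      k%:Z - (2 * n)%:Z = - (dist (2 * n) k)%:Z.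
  - by rewrite /dist; lia.
  - by rewrite expr2 -mulnn.
  - by rewrite sqrrN expr2 -mulnn.
(* If 2j^2 > n, the shifted coefficient is 0, and so is [cubic] at a negative argument. *)
rewrite dE; case: ltnP => [lt|le].
  have : n%:Z - 2 * (dist (2 * n) k ^ 2)%:Z < 0 by lia.
  by case: (_ - _).
rewrite coef_cubic_poly ?leq_subr //; congr (cubic _)%:Z; lia.
Qed.
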